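(* Let $d,K\ge 1$ be integers, $\mathbb X\subseteq\mathbb R^d$, $x_0\in\mathbb R^d$, $\delta\ge 0$, and let $c:\mathbb R^d\times\mathbb R^d\to[0,\infty)$ be continuous. For each $k\in\{1,\dots,K\}$ let $\hat\theta_k\in\mathbb R^d$, let $\hat\Sigma_k$ be a symmetric positive definite $d\times d$ matrix, and let $\rho_k\ge 0$. Let $\hat p\in\mathbb R_+^K$ with $\sum_{k=1}^K\hat p_k=1$. Then the problem $$\min_{x\in\mathbb X}\ \sup_{\mathbb Q\in\mathcal B^{\mathcal N}(\hat{\mathbb P})}\mathbb Q(\tilde\theta^\top x\le 0)\quad\text{s.t.}\quad c(x,x_0)\le\delta,\quad \sup_{\mathbb Q_k\in\mathcal B_k^{\mathcal N}(\hat{\mathbb P}_k)}\mathbb Q_k(\tilde\theta^\top x\le 0)<\tfrac12\ \ \forall k\in\{1,\dots,K\}$$ is equivalent to the finite-dimensional problem $$\min_{x\in\mathcal X}\ 1-\sum_{k=1}^K\hat p_k\,\Phi(g_k(x)),$$ where $$\mathcal X=\left\{x\in\mathbb X:\ c(x,x_0)\le\delta,\ \ -\hat\theta_k^\top x+\rho_k\|x\|_2<0\ \ \forall k\in\{1,\dots,K\}\right\}$$ and $$g_k(x)=\frac{(\hat\theta_k^\top x)^2-\rho_k^2\|x\|_2^2}{\hat\theta_k^\top x\,\sqrt{x^\top\hat\Sigma_k x}+\rho_k\|x\|_2\sqrt{(\hat\theta_k^\top x)^2+x^\top\hat\Sigma_k x-\rho_k^2\|x\|_2^2}}.$$ Here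 equivalence means that the feasible set of the first problem is exactly $\mathcal X$ and that the two objective functions coincide at every $x\in\mathcal X$.
   Context: $\Phi$ is the cumulative distribution function of the standard Gaussian distribution on $\mathbb R$. $\tilde\theta$ denotes a random vector in $\mathbb R^d$ (the identity map on $\mathbb R^d$ under a probability distribution on $\mathbb R^d$); it is the parameter of a linear classifier, and the event that $x$ receives the unfavorable label is identified with $\{\tilde\theta^\top x\le 0\}$. Gelbrich distance: for $(\theta,\Sigma),(\hat\theta,\hat\Sigma)\in\mathbb R^d\times\mathbb S_+^d$ ($\mathbb S_+^d$ is the set of symmetric positive semidefinite $d\times d$ matrices), $$\mathbb G((\theta,\Sigma),(\hat\theta,\hat\Sigma))=\sqrt{\|\theta-\hat\theta\|_2^2+\mathrm{Tr}\big[\Sigma+\hat\Sigma-2(\hat\Sigma^{1/2}\Sigma\hat\Sigma^{1/2})^{1/2}\big]}.$$ The nominal component $\hat{\mathbb P}_k$ is $\mathcal N(\hat\theta_k,\hat\Sigma_k)$, and $$\mathcal B_k^{\mathcal N}(\hat{\mathbb P}_k)=\{\mathbb Q_k:\ \mathbb Q_k\sim\mathcal N(\theta_k,\Sigma_k),\ \mathbb G((\theta_k,\Sigma_k),(\hat\theta_k,\hat\Sigma_k))\le\rho_k\},$$ where $(\theta_k,\Sigma_k)$ ranges over $\mathbb R^d\times\mathbb S_+^d$ (degenerate Gaussians allowed). The mixture ambiguity set $\mathcal B^{\mathcal N}(\hat{\mathbb P})$ is the set of all mixtures $\mathbb Q=\sum_{k=1}^K\hat p_k\mathbb Q_k$ with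 $\mathbb Q_k\in\mathcal B_k^{\mathcal N}(\hat{\mathbb P}_k)$ for all $k$. *)

(* Defs.v *)
From mathcomp Require Export all_boot all_order all_algebra.
From mathcomp Require Export all_classical all_reals all_analysis.
Export Order.TTheory GRing.Theory Num.Theory numFieldNormedType.Exports.

Set Implicit Arguments.
Unset Strict Implicit.
Unset Printing Implicit Defensive.

Local Open Scope classical_set_scope.
Local Open Scope ring_scope.

Section LinearAlgebra.
Context {R : realType} {d : nat}.
Implicit Types (u v x : 'cV[R]_d) (A S : 'M[R]_d).

Definition dotv u v : R := (u^T *m v) 0 0.

Definition qform S x : R := (x^T *m S *m x) 0 0.

(* The library norm on matrices is the sup norm, hence this definition. *)
Definition norm2 x : R := Num.sqrt (dotv x x).

Definition psdmx S : Prop := S^T = S /\ forall x, 0 <= qform S x.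

Definition pdmx S : Prop := S^T = S /\ forall x, x != 0 -> 0 < qform S x.

(* A positive semidefinite matrix has exactly one positive semidefinite square
   root; the default value 0 is only reached when A is not such a matrix. *)
Definition sqrtmx A : 'M[R]_d := xget 0 [set S | psdmx S /\ S *m S = A].

(* The pair is (mean, covariance). The radicand is nonnegative on positive
   semidefinite covariances, so the truncation of Num.sqrt at 0 is harmless. *)
Definition gelbrich (a b : 'cV[R]_d * 'M[R]_d) : R :=
  let rb := sqrtmx b.2 in
  Num.sqrt (norm2 (a.1 - b.1) ^+ 2
            + \tr (a.2 + b.2 - 2%:R *: sqrtmx (rb *m a.2 *m rb))).

End LinearAlgebra.

Section Gaussian.
Context {R : realType}.

(* Borel space R^d, as d-tuples with the product sigma-algebra. *)
Definition Rvec (d : nat) := d.-tuple (measurableTypeR R).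

Definition vec (d : nat) (t : Rvec d) : 'cV[R]_d := \col_i tnth t i.

(* Second parameter: standard deviation. normal_prob m 0 is not the point mass
   at m, so the degenerate case is treated separately. *)
Definition gauss1 (m s : R) : set (measurableTypeR R) -> \bar R :=
  if s == 0 then \d_m else normal_prob m s.

(* Q ~ N(m, S), S possibly singular: every linear functional u of the random
   vector has the univariate Gaussian law N(u^T m, u^T S u). This determines Q
   and makes sense for singular S, where there is no density. *)
Definition gaussian (d : nat) (m : 'cV[R]_d) (S : 'M[R]_d)
    (Q : probability (Rvec d) R) : Prop :=
  forall (u : 'cV[R]_d) (B : set (measurableTypeR R)), measurable B ->
    Q [set t | B (dotv u (vec t))]
    = gauss1 (dotv u m) (Num.sqrt (qform S u)) B.

Definition Phi (z : R) : R := fine (normal_prob (0 : R) 1 `]-oo, z]).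

End Gaussian.
Arguments Rvec : clear implicits.

Section Recourse.
Context {R : realType} {d : nat}.

Definition gaussian_ball (m0 : 'cV[R]_d) (S0 : 'M[R]_d) (rho : R) :
    set (probability (Rvec R d) R) :=
  [set Q | exists m S, [/\ psdmx S, gaussian m S Q
                         & gelbrich (m, S) (m0, S0) <= rho]].

Definition is_mixture (K : nat) (p : 'I_K -> R)
    (Qs : 'I_K -> probability (Rvec R d) R)
    (Q : probability (Rvec R d) R) : Prop :=
  forall B, measurable B -> Q B = (\sum_(k < K) (p k)%:E * Qs k B)%E.

Definition mixture_ball (K : nat) (p : 'I_K -> R) (m0 : 'I_K -> 'cV[R]_d)
    (S0 : 'I_K -> 'M[R]_d) (rho : 'I_K -> R) :
    set (probability (Rvec R d) R) :=
  [set Q | exists Qs : 'I_K -> probability (Rvec R d) R,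
     (forall k, gaussian_ball (m0 k) (S0 k) (rho k) (Qs k)) /\
     is_mixture p Qs Q].

Definition unfavorable (x : 'cV[R]_d) : set (Rvec R d) :=
  [set t | dotv (vec t) x <= 0].

Definition worst_case (U : set (probability (Rvec R d) R)) (x : 'cV[R]_d) :
    \bar R :=
  ereal_sup [set Q (unfavorable x) | Q in U].

Definition robust_feasible (K : nat) (X : set 'cV[R]_d) (x0 : 'cV[R]_d)
    (delta : R) (c : 'cV[R]_d -> 'cV[R]_d -> R) (m0 : 'I_K -> 'cV[R]_d)
    (S0 : 'I_K -> 'M[R]_d) (rho : 'I_K -> R) : set 'cV[R]_d :=
  [set x | [/\ X x, c x x0 <= delta
             & forall k, (worst_case (gaussian_ball (m0 k) (S0 k) (rho k)) x
                          < (2^-1)%:E)%E]].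

Definition finite_feasible (K : nat) (X : set 'cV[R]_d) (x0 : 'cV[R]_d)
    (delta : R) (c : 'cV[R]_d -> 'cV[R]_d -> R) (m0 : 'I_K -> 'cV[R]_d)
    (rho : 'I_K -> R) : set 'cV[R]_d :=
  [set x | [/\ X x, c x x0 <= delta
             & forall k, - dotv (m0 k) x + rho k * norm2 x < 0]].

Definition g (m0 : 'cV[R]_d) (S0 : 'M[R]_d) (rho : R) (x : 'cV[R]_d) : R :=
  (dotv m0 x ^+ 2 - rho ^+ 2 * norm2 x ^+ 2) /
  (dotv m0 x * Num.sqrt (qform S0 x)
   + rho * norm2 x
     * Num.sqrt (dotv m0 x ^+ 2 + qform S0 x - rho ^+ 2 * norm2 x ^+ 2)).

End Recourse.

(* Main.v *)
(* For x <> 0 put s0 = sqrt (x^T S0 x) and r = rho |x|. The pairs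
   (x^T m, sqrt (x^T S x)) realised by a Gelbrich ball around (m0, S0) all lie in
   the half disc of centre (x^T m0, s0) and radius r. Indeed S = A A^T for some A
   whose squared Frobenius distance to S0^(1/2) is the trace term of the distance,
   and one applies (A - S0^(1/2))^T to x. Conversely, the boundary points used
   here are reached by m = m0 - t x and A = (1 + c x x^T) S0^(1/2).
   As the probability of the unfavorable event is Phi (- mean / deviation), the
   worst case is given by the least slope mean / deviation over the disc: that of
   the tangent from the origin, namely g, when r < x^T m0. Otherwise the disc
   contains a point with nonpositive mean, whose probability is at least 1/2.
   A mixture is then maximised component by component. *)

From HB Require Import structures.
From mathcomp Require Import complex.
Require Import Defs.
From mathcomp Require Import measurable_realfun ring lra.

Set Implicit Arguments.
Unset Strict Implicit.
Unset Printing Implicit Defensive.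

Local Open Scope classical_set_scope.
Local Open Scope ring_scope.

(** * Quadratic forms, square roots and the Gelbrich distance *)

(** Newton's scheme: a new node is accommodated by adding a multiple of the polynomial [q] that
    vanishes at the earlier nodes. *)
Lemma poly_interpolation (F : fieldType) (f : F -> F) (s : seq F) :
  exists p : {poly F}, {in s, forall x, p.[x] = f x}.
Proof.
elim: s => [|x s [p hp]]; first by exists 0.
have [xs|xs] := boolP (x \in s).
  by exists p => y; rewrite inE => /orP[/eqP ->|]; exact: hp.
pose q : {poly F} := \prod_(z <- s) ('X - z%:P).
have qx : q.[x] != 0 by have := root_prod_XsubC s x; rewrite (negbTE xs) => /negbT.
exists (p + ((f x - p.[x]) / q.[x]) *: q) => y; rewrite !hornerE inE.
case/orP => [/eqP ->|ys]; first by rewrite divfK// addrC subrK.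
have /eqP -> : root q y by rewrite root_prod_XsubC.
by rewrite mulr0 addr0 hp.
Qed.

Section linear_algebra.
Context {R : realType}.

Lemma dotvE n (u v : 'cV[R]_n) : dotv u v = \sum_i u i 0 * v i 0.
Proof. by rewrite /dotv mxE; apply: eq_bigr => i _; rewrite mxE. Qed.

Lemma dotvC n (u v : 'cV[R]_n) : dotv u v = dotv v u.
Proof. by rewrite !dotvE; apply: eq_bigr => i _; rewrite mulrC. Qed.

Lemma dotvDl n (u v w : 'cV[R]_n) : dotv (u + v) w = dotv u w + dotv v w.
Proof. by rewrite /dotv linearD mulmxDl mxE. Qed.

Lemma dotvZl n a (u w : 'cV[R]_n) : dotv (a *: u) w = a * dotv u w.
Proof. by rewrite /dotv linearZ /= -scalemxAl mxE. Qed.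

Lemma dotvBl n (u v w : 'cV[R]_n) : dotv (u - v) w = dotv u w - dotv v w.
Proof. by rewrite -scaleN1r dotvDl dotvZl mulN1r. Qed.

Lemma dotvBr n (u v w : 'cV[R]_n) : dotv w (u - v) = dotv w u - dotv w v.
Proof. by rewrite ![dotv w _]dotvC dotvBl. Qed.

Lemma dotvZr n a (u w : 'cV[R]_n) : dotv w (a *: u) = a * dotv w u.
Proof. by rewrite ![dotv w _]dotvC dotvZl. Qed.

Lemma dotv_ge0 n (u : 'cV[R]_n) : 0 <= dotv u u.
Proof. by rewrite dotvE sumr_ge0 // => i _; rewrite -expr2 sqr_ge0. Qed.

Lemma dotv_eq0 n (u : 'cV[R]_n) : (dotv u u == 0) = (u == 0).
Proof.
apply/eqP/eqP => [|->]; last by rewrite -(scale0r 0) dotvZl mul0r.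
rewrite dotvE => /psumr_eq0P u0; apply/matrixP => i j; rewrite ord1 mxE.
by apply/eqP; rewrite -sqrf_eq0 expr2 u0 // => k _; rewrite -expr2 sqr_ge0.
Qed.

Lemma dotv_gt0 n (u : 'cV[R]_n) : u != 0 -> 0 < dotv u u.
Proof. by move=> u0; rewrite lt_neqAle eq_sym dotv_eq0 u0 dotv_ge0. Qed.

Lemma norm2_ge0 n (u : 'cV[R]_n) : 0 <= norm2 u.
Proof. exact: sqrtr_ge0. Qed.

Lemma sqr_norm2 n (u : 'cV[R]_n) : norm2 u ^+ 2 = dotv u u.
Proof. by rewrite sqr_sqrtr ?dotv_ge0. Qed.

Lemma norm2_gt0 n (u : 'cV[R]_n) : u != 0 -> 0 < norm2 u.
Proof. by move=> u0; rewrite sqrtr_gt0 dotv_gt0. Qed.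

Lemma norm2Z n a (u : 'cV[R]_n) : norm2 (a *: u) = `|a| * norm2 u.
Proof.
by rewrite /norm2 dotvZl dotvZr mulrA -expr2 sqrtrM ?sqr_ge0 // sqrtr_sqr.
Qed.

(** Cauchy-Schwarz: for [v] nonzero, the gap times [dotv v v] is the squared norm of
    [dotv v v *: u - dotv u v *: v]. *)
Lemma dotv_sqr_le n (u v : 'cV[R]_n) :
  dotv u v ^+ 2 <= dotv u u * dotv v v.
Proof.
have [->|/dotv_gt0 v0] := eqVneq v 0.
  by rewrite -(scale0r 0) !dotvZr !mul0r mulr0 expr2 mul0r.
rewrite -subr_ge0 -(pmulr_rge0 _ v0).
have -> : dotv v v * (dotv u u * dotv v v - dotv u v ^+ 2)
   = dotv (dotv v v *: u - dotv u v *: v) (dotv v v *: u - dotv u v *: v).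
  rewrite !(dotvBl, dotvBr, dotvZl, dotvZr) (dotvC v u); ring.
exact: dotv_ge0.
Qed.

Lemma dotv_le_norm2 n (u v : 'cV[R]_n) : dotv u v <= norm2 u * norm2 v.
Proof.
apply: le_trans (ler_norm _) _.
rewrite -(@ler_pXn2r _ 2) ?nnegrE ?mulr_ge0 ?norm2_ge0 //.
by rewrite real_normK ?num_real // exprMn !sqr_norm2 dotv_sqr_le.
Qed.

Lemma norm2B_ge n (u v : 'cV[R]_n) :
  (norm2 u - norm2 v) ^+ 2 <= dotv (u - v) (u - v).
Proof.
have := dotv_le_norm2 u v.
rewrite !(dotvBl, dotvBr) -!sqr_norm2 (dotvC v u); nra.
Qed.

Lemma dotv_mulmx m n (A : 'M[R]_(m, n)) u v :
  dotv u (A *m v) = dotv (A^T *m u) v.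
Proof. by rewrite /dotv trmx_mul trmxK mulmxA. Qed.

Lemma qform_mul m n (A : 'M[R]_(m, n)) u :
  qform (A *m A^T) u = dotv (A^T *m u) (A^T *m u).
Proof. by rewrite -dotv_mulmx /dotv /qform !mulmxA. Qed.

Lemma psdmx_mul_tr m n (A : 'M[R]_(m, n)) : psdmx (A *m A^T).
Proof.
split; first by rewrite trmx_mul trmxK.
by move=> x; rewrite qform_mul dotv_ge0.
Qed.

Lemma psdmx_congr m n (A : 'M[R]_(m, n)) (S : 'M[R]_n) :
  psdmx S -> psdmx (A *m S *m A^T).
Proof.
case=> St Sp; split; first by rewrite !trmx_mul trmxK St mulmxA.
move=> x; have := Sp (A^T *m x).
by rewrite /qform trmx_mul trmxK !mulmxA.
Qed.

Lemma mxtrace_mul_tr_ge0 m n (A : 'M[R]_(m, n)) : 0 <= \tr (A *m A^T).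
Proof.
rewrite /mxtrace sumr_ge0 // => i _; rewrite mxE sumr_ge0 // => j _.
by rewrite mxE -expr2 sqr_ge0.
Qed.

Lemma mxtrace_mul_tr_eq0 m n (A : 'M[R]_(m, n)) :
  \tr (A *m A^T) = 0 -> A = 0.
Proof.
move/psumr_eq0P => H; apply/matrixP => i j; rewrite [RHS]mxE.
have : (A *m A^T) i i = 0.
  apply: H => // k _; rewrite mxE sumr_ge0 // => l _.
  by rewrite mxE -expr2 sqr_ge0.
rewrite mxE => /psumr_eq0P H'; apply/eqP; rewrite -sqrf_eq0 expr2.
have := H' _ j erefl; rewrite mxE => -> // l _.
by rewrite mxE -expr2 sqr_ge0.
Qed.

(** The Frobenius norm dominates the operator norm: Cauchy-Schwarz is applied to each column of [A]
    and the bounds are summed. *)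
Lemma dotv_mulmx_le_trace m n (A : 'M[R]_(m, n)) (x : 'cV[R]_m) :
  dotv (A^T *m x) (A^T *m x) <= \tr (A *m A^T) * dotv x x.
Proof.
rewrite [X in X <= _]dotvE mxtrace_mulC /mxtrace mulr_suml ler_sum // => j _.
have -> : (A^T *m x) j 0 = dotv (col j A) x.
  by rewrite dotvE mxE; apply: eq_bigr => i _; rewrite !mxE.
have -> : (A^T *m A) j j = dotv (col j A) (col j A).
  by rewrite dotvE mxE; apply: eq_bigr => i _; rewrite !mxE.
by rewrite -expr2 dotv_sqr_le.
Qed.

(** * Square roots of positive semidefinite matrices *)

Lemma psdmx_eigenvalue_ge0 n (S : 'M[R]_n) a :
  psdmx S -> eigenvalue S a -> 0 <= a.
Proof.
move=> [_ Sp] /eigenvalueP [v vS v0]; have := Sp v^T.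
have vT0 : v^T != 0 by rewrite -trmx0 (inj_eq trmx_inj).
rewrite /qform trmxK vS -scalemxAl mxE pmulr_lge0 //.
by have := dotv_gt0 vT0; rewrite /dotv trmxK.
Qed.

Lemma trmx_horner n (A : 'M[R]_n.+1) (p : {poly R}) :
  A^T = A -> (horner_mx A p)^T = horner_mx A p.
Proof.
move=> At; elim/poly_ind: p => [|p c IH]; first by rewrite rmorph0 trmx0.
rewrite rmorphD rmorphM /= horner_mx_X horner_mx_C linearD /= tr_scalar_mx.
by rewrite -[_ * A]/(_ *m A) trmx_mul At IH; congr (_ + _); exact: comm_mx_horner.
Qed.

(* Over R[i] a real symmetric matrix is unitarily similar to a diagonal matrix,
   whose entries are eigenvalues of the real matrix; hence a real polynomial
   vanishing on these eigenvalues annihilates it. *)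
Lemma symmetric_horner_mx n (A : 'M[R]_n.+1) : A^T = A ->
  exists s : seq R, {in s, forall a, eigenvalue A a} /\
    forall p : {poly R}, {in s, forall a, p.[a] = 0} -> horner_mx A p = 0.
Proof.
move=> At; pose f := real_complex R; pose B := map_mx f A.
have Bh : B \is hermsymmx.
  apply: realsym_hermsym.
    apply/is_hermitianmxP; rewrite expr0 scale1r map_mx_id //.
    by rewrite {2}/B map_trmx At.
  by apply/mxOverP => i j; rewrite mxE; apply/complex_realP; exists (A i j).
have /orthomx_spectralP BE := hermitian_normalmx Bh.
have Dr := hermitian_spectral_diag_real Bh.
set P := spectralmx B in BE; set D := spectral_diag B in BE Dr.
have Pu : P \in unitmx by exact: spectral_unit.
have DE i : D 0 i = f (complex.Re (D 0 i)).
  by move/mxOverP: Dr => /(_ 0 i) /complex_realP [r ->].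
exists [seq complex.Re (D 0 i) | i : 'I_n.+1]; split.
  move=> a /mapP[i _ ->].
  have : root (char_poly B) (f (complex.Re (D 0 i))).
    (* Row [i] of [P] is an eigenvector of [B], nonzero because [P] is invertible; the root of
       [char_poly B] then descends to [A]. *)
    rewrite -DE -eigenvalue_root_char; apply/eigenvalueP; exists (row i P).
      rewrite BE -!mulmxA -row_mul mulKVmx //.
      by rewrite mul_diag_mx; apply/rowP => j; rewrite !mxE.
    rewrite rowE; apply: contraNneq (oner_neq0 R[i]) => r0.
    have : delta_mx 0 i = 0 :> 'rV[R[i]]_n.+1.
      by rewrite -(mulmxK Pu (delta_mx 0 i)) r0 mul0mx.
    by move/rowP => /(_ i); rewrite !mxE !eqxx => /eqP.
  by rewrite -map_char_poly fmorph_root -eigenvalue_root_char.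
move=> p p0; apply: (@map_mx_inj _ _ (real_complex R)).
rewrite map_horner_mx map_mx0 -[map_mx _ A]/B BE.
rewrite horner_mx_uconjC // horner_mx_diag.
have -> : map_mx (horner (map_poly f p)) D = 0.
  apply/rowP => i; rewrite mxE [RHS]mxE DE horner_map p0 ?rmorph0 //.
  by apply/mapP; exists i => //; rewrite mem_enum.
by rewrite raddf0 mulmx0 mul0mx.
Qed.

(** Let [q] interpolate the fourth root on the spectrum. As [q(A)] is symmetric, its square is
    positive semidefinite; as [q^4 - X] vanishes on the nonnegative eigenvalues, [q(A)^4 = A]. *)
Lemma psdmx_sqrt_exists n (A : 'M[R]_n) :
  psdmx A -> exists S, psdmx S /\ S *m S = A.
Proof.
case: n A => [|n] A [At Ap].
  exists 0; split; last by rewrite (flatmx0 A) mulmx0.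
  by split; [rewrite trmx0|move=> x; rewrite /qform mulmx0 mul0mx mxE].
have [s [sA sp]] := symmetric_horner_mx At.
have [q hq] := poly_interpolation (fun a : R => Num.sqrt (Num.sqrt a)) s.
have Qt : (horner_mx A q)^T = horner_mx A q by exact: trmx_horner.
exists (horner_mx A q *m horner_mx A q); split.
  by rewrite -{2}Qt; exact: psdmx_mul_tr.
rewrite -[LHS]/(horner_mx A q * horner_mx A q * (horner_mx A q * horner_mx A q)).
rewrite -[RHS](horner_mx_X A) -!rmorphM.
apply/eqP; rewrite -subr_eq0 -rmorphB; apply/eqP/sp => a /[dup] /sA Aa sa.
rewrite hornerD hornerN hornerX !hornerM hq // -!expr2 sqr_sqrtr ?sqrtr_ge0 //.
by rewrite sqr_sqrtr ?subrr // (psdmx_eigenvalue_ge0 (conj At Ap)).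
Qed.

(** With [D = S - T], the equality of squares gives [D S + T D = 0], so [D S D] and [D T D] have
    traces of sum zero. Each trace is a squared Frobenius norm, of [D C] and [D E] for roots [C],
    [E] of [S], [T]; hence [D S = D T = 0] and [D D = 0]. *)
Lemma psdmx_sqrt_unique n (S T : 'M[R]_n) :
  psdmx S -> psdmx T -> S *m S = T *m T -> S = T.
Proof.
move=> Sp Tp ST; pose D := S - T.
have Dt : D^T = D by rewrite linearB /= Sp.1 Tp.1.
have [C [[Ct _] CS]] := psdmx_sqrt_exists Sp.
have [E [[Et _] ET]] := psdmx_sqrt_exists Tp.
have DSTD : D *m S + T *m D = 0.
  by rewrite mulmxBl mulmxBr ST addrA subrK subrr.
have : \tr ((D *m C) *m (D *m C)^T) + \tr ((D *m E) *m (D *m E)^T) = 0.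
  rewrite !trmx_mul Dt Ct Et !mulmxA -(mulmxA D C C) -(mulmxA D E E) CS ET.
  rewrite -(mulmxA D T D) (mxtrace_mulC D) -linearD /= -mulmxDl DSTD mul0mx.
  by rewrite mxtrace0.
move/eqP; rewrite paddr_eq0 ?mxtrace_mul_tr_ge0 // => /andP[/eqP DC /eqP DE].
have {}DC := mxtrace_mul_tr_eq0 DC; have {}DE := mxtrace_mul_tr_eq0 DE.
apply/subr0_eq/mxtrace_mul_tr_eq0; rewrite -/D Dt mulmxBr.
by rewrite -CS -ET !mulmxA DC DE !mul0mx subrr mxtrace0.
Qed.

Lemma sqrtmxP n (A : 'M[R]_n) : psdmx A ->
  psdmx (sqrtmx A) /\ sqrtmx A *m sqrtmx A = A.
Proof. by move=> /psdmx_sqrt_exists Sex; exact: (xgetPex 0 Sex). Qed.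

Lemma sqrtmx_eq n (A S : 'M[R]_n) : psdmx S -> S *m S = A -> sqrtmx A = S.
Proof.
move=> Sp SA; have Ap : psdmx A by rewrite -SA -{2}Sp.1; exact: psdmx_mul_tr.
have [Tp TA] := sqrtmxP Ap.
by apply: psdmx_sqrt_unique => //; rewrite TA.
Qed.

(** * Factorisations of covariances and the Gelbrich distance *)

Lemma pdmx_psd n (S : 'M[R]_n) : pdmx S -> psdmx S.
Proof.
move=> [St Sp]; split=> // x; have [->|/Sp/ltW //] := eqVneq x 0.
by rewrite /qform mulmx0 mxE.
Qed.

Lemma pdmx_unit n (S : 'M[R]_n) : pdmx S -> S \in unitmx.
Proof.
move=> [_ Sp]; rewrite -row_free_unit; apply: inj_row_free => v vS0.
apply: contraTeq isT => v0; have vT0 : v^T != 0 by rewrite -trmx0 (inj_eq trmx_inj).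
by have := Sp _ vT0; rewrite /qform trmxK vS0 mul0mx mxE ltxx.
Qed.

(** When [A *m A^T = S], [B] is the root of [S0] and [B *m A] is the root of [B S B], the right side
    is the trace term of the Gelbrich distance. *)
Lemma frobenius_sub n (A B : 'M[R]_n) : B^T = B ->
  \tr ((A - B) *m (A - B)^T) = \tr (A *m A^T + B *m B - 2%:R *: (B *m A)).
Proof.
move=> Bt; rewrite linearB /= Bt mulmxBl !mulmxBr !linearB !linearD linearZ /=.
have -> : \tr (B *m A^T) = \tr (B *m A).
  by rewrite -mxtrace_tr trmx_mul trmxK Bt mxtrace_mulC.
rewrite (mxtrace_mulC A B); ring.
Qed.

(* With B = S0^(1/2) and M = (B S B)^(1/2), the matrix A = B^-1 M factors S as
   A A^T and realises the trace term of the distance as a squared Frobenius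
   norm |A - B|^2; applying (A - B)^T to x gives the bound. *)
Lemma gelbrich_dotv_qform n (m m0 : 'cV[R]_n) (S S0 : 'M[R]_n) (rho : R) x :
    psdmx S -> pdmx S0 -> 0 <= rho -> gelbrich (m, S) (m0, S0) <= rho ->
  (dotv m x - dotv m0 x) ^+ 2
  + (Num.sqrt (qform S x) - Num.sqrt (qform S0 x)) ^+ 2
  <= (rho * norm2 x) ^+ 2.
Proof.
move=> Sp S0p rho0; rewrite /gelbrich /=.
have [Bp BB] := sqrtmxP (pdmx_psd S0p); set B := sqrtmx S0 in Bp BB *.
have Bu : B \in unitmx.
  by have := pdmx_unit S0p; rewrite -BB unitmx_mul => /andP[].
have BSBp : psdmx (B *m S *m B) by rewrite -[X in _ *m X]Bp.1; exact: psdmx_congr.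
have [Mp MM] := sqrtmxP BSBp; set M := sqrtmx _ in Mp MM *.
pose A := invmx B *m M.
have AS : A *m A^T = S.
  rewrite trmx_mul trmx_inv Bp.1 Mp.1 !mulmxA -(mulmxA _ M M) MM.
  by rewrite -!mulmxA mulmxV // mulmx1 mulKmx.
have -> : S + S0 - 2%:R *: M = A *m A^T + B *m B - 2%:R *: (B *m A).
  by rewrite AS BB mulKVmx.
rewrite -frobenius_sub ?Bp.1 // sqr_norm2 => G.
have {}G : dotv (m - m0) (m - m0) + \tr ((A - B) *m (A - B)^T) <= rho ^+ 2.
  rewrite -[X in X <= _]sqr_sqrtr ?addr_ge0 ?dotv_ge0 ?mxtrace_mul_tr_ge0 //.
  by rewrite ler_pXn2r ?nnegrE ?sqrtr_ge0.
have -> : Num.sqrt (qform S x) = norm2 (A^T *m x) by rewrite -AS qform_mul.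
have -> : Num.sqrt (qform S0 x) = norm2 (B^T *m x).
  by rewrite -BB -{2}Bp.1 qform_mul.
rewrite -dotvBl exprMn sqr_norm2.
apply: le_trans (ler_wpM2r (dotv_ge0 x) G); rewrite mulrDl.
apply: lerD; first exact: dotv_sqr_le.
apply: le_trans (norm2B_ge _ _) _.
by rewrite -mulmxBl -linearB; exact: dotv_mulmx_le_trace.
Qed.

Lemma mulmx_dotv n (u v w : 'cV[R]_n) : u *m v^T *m w = dotv v w *: u.
Proof. by rewrite -mulmxA (mx11_scalar (v^T *m w)) mul_mx_scalar. Qed.

Lemma mxtrace_rank1 n (u v : 'cV[R]_n) :
  \tr ((u *m v^T) *m (u *m v^T)^T) = dotv u u * dotv v v.
Proof.
rewrite trmx_mul trmxK mulmxA mulmx_dotv -scalemxAl linearZ /= mulrC.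
by rewrite mxtrace_mulC /mxtrace big_ord1.
Qed.

(** A factor of the covariance [T S0 T] with [T = 1 + c x x^T]. For [c >= 0] the map [T] is positive
    semidefinite, hence an optimal transport map from [N(0, S0)], and it moves points along [x]
    only. *)
Definition stretch n (S0 : 'M[R]_n) (c : R) (x : 'cV[R]_n) : 'M[R]_n :=
  (1%:M + c *: (x *m x^T)) *m sqrtmx S0.

Section stretch.
Context n (S0 : 'M[R]_n) (c : R) (x m0 : 'cV[R]_n).
Hypotheses (S0p : psdmx S0) (c0 : 0 <= c).
Let A := stretch S0 c x.
Let B := sqrtmx S0.
Let T := 1%:M + c *: (x *m x^T).

Let Bp : psdmx B. Proof. by have [] := sqrtmxP S0p. Qed.
Let BB : B *m B = S0. Proof. by have [] := sqrtmxP S0p. Qed.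
Let Tt : T^T = T.
Proof. by rewrite linearD linearZ /= trmx1 trmx_mul trmxK. Qed.

Lemma qform_stretch : Num.sqrt (qform (A *m A^T) x)
  = (1 + c * norm2 x ^+ 2) * Num.sqrt (qform S0 x).
Proof.
have -> : qform S0 x = dotv (B *m x) (B *m x).
  by rewrite -BB -{2}Bp.1 qform_mul Bp.1.
have Tx : T *m x = (1 + c * norm2 x ^+ 2) *: x.
  by rewrite mulmxDl mul1mx -scalemxAl mulmx_dotv scalerA sqr_norm2 scalerDl scale1r.
rewrite qform_mul trmx_mul -/T -/B Tt Bp.1 -mulmxA Tx -scalemxAr.
rewrite -[LHS]/(norm2 _) norm2Z ger0_norm //.
by apply: addr_ge0 => //; apply: mulr_ge0 => //; exact: sqr_ge0.
Qed.

(** The inner root is explicit: [B A = B T B] is positive semidefinite and squares to [B A A^T B].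
    The difference [A - B] is then the rank one matrix [c x (B x)^T], whose Frobenius norm is a
    product of norms. *)
Lemma gelbrich_stretch t :
  gelbrich (m0 - t *: x, A *m A^T) (m0, S0)
  = Num.sqrt ((t * norm2 x) ^+ 2 + (c * norm2 x) ^+ 2 * qform S0 x).
Proof.
rewrite /gelbrich /= -/B.
have At : A^T *m B = B *m A by rewrite trmx_mul -/T -/B Tt Bp.1 !mulmxA.
have -> : sqrtmx (B *m (A *m A^T) *m B) = B *m A.
  apply: sqrtmx_eq; last by rewrite !mulmxA -!(mulmxA _ _ B) At !mulmxA.
  rewrite /A /stretch -/T -/B mulmxA -{2}Bp.1; apply: psdmx_congr.
  split=> // y; have -> : qform T y = dotv (T *m y) y by rewrite dotvC /dotv mulmxA.
  rewrite mulmxDl mul1mx -scalemxAl mulmx_dotv scalerA dotvDl dotvZl -mulrA.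
  by apply: addr_ge0; [exact: dotv_ge0|rewrite mulr_ge0 // -expr2 sqr_ge0].
rewrite -[in X in _ + X]BB -frobenius_sub ?Bp.1 //.
have -> : A - B = (c *: x) *m (B *m x)^T.
  rewrite /A /stretch -/B mulmxDl mul1mx addrAC subrr add0r.
  by rewrite trmx_mul Bp.1 -!scalemxAl mulmxA.
rewrite mxtrace_rank1 addrAC subrr add0r -scaleNr norm2Z normrN.
rewrite -BB -{4}Bp.1 qform_mul Bp.1 dotvZl dotvZr -sqr_norm2.
congr Num.sqrt; rewrite !exprMn real_normK ?num_real //; ring.
Qed.

End stretch.

End linear_algebra.

(** * Normal distributions *)

Section normal_distribution.
Context {R : realType}.
Notation mu := (@lebesgue_measure R).
Implicit Types (a b m s z : R) (B : set (measurableTypeR R)).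

(** Named so that it can carry the measurable-function instance declared below. *)
Definition affine a b (x : measurableTypeR R) : measurableTypeR R := a * x + b.

Lemma measurable_affine a b : measurable_fun [set: measurableTypeR R] (affine a b).
Proof. by apply: measurable_funD => //; apply: measurable_funM. Qed.

HB.instance Definition _ a b :=
  isMeasurableFun.Build _ _ _ _ (affine a b) (measurable_affine a b).

(** By uniqueness of Lebesgue measure, it suffices to compare lengths on intervals []p, q]]. For
    negative [a] the preimage is closed on the left instead, with the same length. *)
Lemma lebesgue_measure_affine a b B : a != 0 -> measurable B ->
  mu B = (`|a|%:E * mu (affine a b @^-1` B))%E.
Proof.
move=> a0 mB.
pose k : {nonneg R} := NngNum (normr_ge0 a).
rewrite (@lebesgue_measure_unique _ (mscale k (pushforward mu (affine a b)))) //.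
move=> _ [[p q] _ <-] /=.
rewrite -[RHS]/(`|a|%:E * mu (affine a b @^-1` `]p, q]))%E.
have [a_gt0|] := ltP 0 a.
  have -> : affine a b @^-1` `]p, q]%classic = `](p - b) / a, (q - b) / a]%classic.
    apply/seteqP; split => x; rewrite /affine /= !in_itv /=;
    by rewrite ltr_pdivrMr // ler_pdivlMr // ltrBlDr lerBrDr mulrC.
  rewrite !lebesgue_measure_itv /= !lte_fin ltr_pM2r ?invr_gt0 // ltrD2r.
  case: ifP => _; last by rewrite mule0.
  rewrite -!EFinD -EFinM (gtr0_norm a_gt0); congr EFin; field; exact: a0.
rewrite le_eqVlt (negbTE a0) /= => a_lt0.
have -> : affine a b @^-1` `]p, q]%classic = `[(q - b) / a, (p - b) / a[%classic.
  apply/seteqP; split => x; rewrite /affine /= !in_itv /=;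
  by rewrite ler_ndivrMr // ltr_ndivlMr // ltrBlDr lerBrDr mulrC andbC.
rewrite !lebesgue_measure_itv /= !lte_fin ltr_nM2r ?invr_lt0 // ltrD2r.
case: ifP => _; last by rewrite mule0.
rewrite -!EFinD -EFinM (ltr0_norm a_lt0); congr EFin; field; exact: a0.
Qed.

Lemma ge0_integral_affine a b B (f : R -> \bar R) : a != 0 -> measurable B ->
    measurable_fun B f -> (forall x, 0 <= f x)%E ->
  (\int[mu]_(x in B) f x
   = `|a|%:E * \int[mu]_(x in affine a b @^-1` B) f (affine a b x))%E.
Proof.
move=> a0 mB mf f0; pose k : {nonneg R} := NngNum (normr_ge0 a).
rewrite -(ge0_integral_pushforward (measurable_affine a b)) //.
rewrite -(@ge0_integral_mscale _ _ _ _ _ _ k) //.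
apply: eq_measure_integral => A mA _.
by rewrite -[RHS]/(`|a|%:E * mu (affine a b @^-1` A))%E -lebesgue_measure_affine.
Qed.

Lemma normal_pdf_affine a b m s x : a != 0 -> s != 0 ->
  `|a| * normal_pdf (a * m + b) (`|a| * s) (affine a b x) = normal_pdf m s x.
Proof.
move=> a0 s0; have as0 : `|a| * s != 0 by rewrite mulf_neq0 ?normr_eq0.
rewrite !normal_pdfE // mulrA; congr (_ * _).
  rewrite /normal_peak exprMn -mulrA -mulrnAr sqrtrM ?sqr_ge0 // sqrtr_sqr normr_id.
  by rewrite invfM mulrA mulfV ?normr_eq0 // mul1r.
rewrite /normal_fun /affine; congr expR.
rewrite exprMn real_normK ?num_real //; field.
by rewrite a0 s0.
Qed.

Lemma normal_prob_affine a b m s B : a != 0 -> s != 0 -> measurable B ->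
  normal_prob m s (affine a b @^-1` B) = normal_prob (a * m + b) (`|a| * s) B.
Proof.
move=> a0 s0 mB; rewrite /normal_prob.
have mpdf m' s' (D : set (measurableTypeR R)) :
  measurable_fun D (fun x : measurableTypeR R => (normal_pdf m' s' x)%:E).
  by apply/measurable_funTS/measurable_EFinP; exact: measurable_normal_pdf.
rewrite [RHS](ge0_integral_affine b a0) //; last first.
  by move=> x; rewrite lee_fin normal_pdf_ge0.
rewrite -ge0_integralZl //=.
- by apply: eq_integral => x _; rewrite -EFinM normal_pdf_affine.
- by rewrite -[X in measurable X]setTI; exact: measurable_affine.
- exact: (measurableT_comp (mpdf _ _ setT)
           (measurable_funTS (measurable_affine a b))).
- by move=> x _; rewrite lee_fin normal_pdf_ge0.
Qed.

(** The Radon-Nikodym derivative of [normal_prob] agrees almost everywhere with [normal_pdf], both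
    having the same integral over every measurable set. *)
Lemma integral_normal_prob m s (f : measurableTypeR R -> \bar R) :
    measurable_fun setT f -> (\int[normal_prob m s]_x `|f x| < +oo)%E ->
  (\int[normal_prob m s]_x f x = \int[mu]_x (f x * (normal_pdf m s x)%:E))%E.
Proof.
move=> mf finf.
rewrite -(Radon_Nikodym_change_of_variables (normal_prob_dominates m s)) //=;
  last by apply/integrableP; split.
have mpdf : measurable_fun [set: measurableTypeR R] (fun x => (normal_pdf m s x)%:E).
  by apply/measurable_EFinP; exact: measurable_normal_pdf.
apply: ae_eq_integral => //.
- apply: emeasurable_funM => //; apply: (measurable_int mu).
  by apply: Radon_Nikodym_integrable; exact: normal_prob_dominates.
- exact: emeasurable_funM.
- apply: ae_eqe_mul2l => /=.
  rewrite Radon_NikodymE //=; first exact: normal_prob_dominates.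
  move=> abmu; case: cid => /= h [h1 h2 h3].
  apply: integral_ae_eq => //= E E01 mE; by rewrite -h3.
Qed.

Lemma probability_integral_lty d (T : measurableType d) (P : probability T R)
    (f : T -> \bar R) :
  measurable_fun setT f -> (forall x, 0 <= f x <= 1)%E -> (\int[P]_x `|f x| < +oo)%E.
Proof.
move=> mf f01; apply: (@le_lt_trans _ _ (\int[P]_x cst 1 x)%E); last first.
  rewrite integral_cst // mul1e.
  by apply: le_lt_trans (probability_le1 P measurableT) _; exact: ltry.
apply: ge0_le_integral => //; first exact: measurableT_comp.
by move=> x _; have /andP[f0 f1] := f01 x; rewrite gee0_abs.
Qed.

(** Completing the square in [x]: a joint density is rewritten as the marginal density of [y] times
    the conditional density of [x] given [y]. *)
Lemma normal_pdf_mul s1 s2 x y : s1 != 0 -> s2 != 0 ->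
  let s := Num.sqrt (s1 ^+ 2 + s2 ^+ 2) in
  normal_pdf x s2 y * normal_pdf 0 s1 x
  = normal_pdf 0 s y * normal_pdf (s1 ^+ 2 * y / s ^+ 2) (s1 * s2 / s) x.
Proof.
move=> s10 s20 s.
have ss : s ^+ 2 = s1 ^+ 2 + s2 ^+ 2 by rewrite sqr_sqrtr // addr_ge0 ?sqr_ge0.
have s2gt : 0 < s1 ^+ 2 + s2 ^+ 2.
  by rewrite ltr_wpDr ?sqr_ge0 // lt_neqAle sqr_ge0 eq_sym sqrf_eq0 s10.
have s0 : s != 0 by rewrite -sqrf_eq0 ss gt_eqF.
clearbody s; rewrite !normal_pdfE ?mulf_neq0 ?invr_eq0 //.
rewrite mulrACA [RHS]mulrACA; congr (_ * _).
  have q (t : R) : 0 <= t ^+ 2 * (pi *+ 2).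
    by apply: mulr_ge0; [exact: sqr_ge0|rewrite mulrn_wge0 ?pi_ge0].
  rewrite /normal_peak -!mulrnAr -!invfM -!sqrtrM //.
  by congr (Num.sqrt _)^-1; rewrite !exprMn exprVn; field.
rewrite /normal_fun -!expRD; congr expR; rewrite !exprMn exprVn ss; field.
by rewrite s10 s20 gt_eqF.
Qed.

End normal_distribution.

(** * Convolution and existence of Gaussian vectors *)

Section gaussian_vector.
Context {R : realType}.
Notation mu := (@lebesgue_measure R).
Implicit Types (a b m s z : R) (B : set (measurableTypeR R)).

Lemma normal_probE m s B : measurable B ->
  normal_prob m s B = (\int[mu]_y ((normal_pdf m s y)%:E * (\1_B y)%:E))%E.
Proof.
move=> mB; rewrite /normal_prob integral_mkcond; apply: eq_integral => y _.
by rewrite patchE indicE; case: ifP; rewrite ?mule1 ?mule0.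
Qed.

Lemma measurable_normal_pdf2 s : s != 0 ->
  measurable_fun [set: measurableTypeR R * measurableTypeR R]
    (fun p => normal_pdf p.1 s p.2).
Proof.
move=> s0.
have -> : (fun p : measurableTypeR R * measurableTypeR R =>
    normal_pdf p.1 s p.2) = normal_pdf 0 s \o (fun p => p.2 - p.1).
  by apply/funext => p /=; rewrite !normal_pdfE // /normal_fun subr0.
apply: measurableT_comp; first exact: measurable_normal_pdf.
by apply: measurable_funB.
Qed.

(** This is the measurability of the inner integral in Tonelli's theorem, for a density jointly
    measurable in mean and point. *)
Lemma measurable_normal_prob_mean s B : s != 0 -> measurable B ->
  measurable_fun [set: measurableTypeR R] (fun x => normal_prob x s B).
Proof.
move=> s0 mB.
pose f (p : measurableTypeR R * measurableTypeR R) :=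
  ((normal_pdf p.1 s p.2)%:E * (\1_B p.2)%:E)%E.
have mf : measurable_fun setT f.
  apply: emeasurable_funM; apply/measurable_EFinP.
    exact: measurable_normal_pdf2.
  by apply: measurableT_comp => //; exact: measurable_indic.
have f0 p : (0 <= f p)%E by rewrite /f -EFinM lee_fin mulr_ge0 ?normal_pdf_ge0.
have := @measurable_fun_fubini_tonelli_F _ _ _ _ R mu f mf f0.
by apply: eq_measurable_fun => x _; rewrite /fubini_F normal_probE.
Qed.

(* Tonelli, with the factorisation of the joint density in [normal_pdf_mul]. *)
Lemma normal_prob_conv s1 s2 B : s1 != 0 -> s2 != 0 -> measurable B ->
  (\int[normal_prob 0 s1]_x normal_prob x s2 B
   = normal_prob (0 : R) (Num.sqrt (s1 ^+ 2 + s2 ^+ 2)) B)%E.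
Proof.
move=> s10 s20 mB; have mN := measurable_normal_prob_mean s20 mB.
rewrite integral_normal_prob //; last first.
  apply: probability_integral_lty => // x.
  by rewrite measure_ge0 probability_le1.
pose f (p : measurableTypeR R * measurableTypeR R) :=
  ((normal_pdf p.1 s2 p.2)%:E * (\1_B p.2)%:E * (normal_pdf 0 s1 p.1)%:E)%E.
have mf : measurable_fun setT f.
  apply: emeasurable_funM; [apply: emeasurable_funM|]; apply/measurable_EFinP.
  - exact: measurable_normal_pdf2.
  - by apply: measurableT_comp => //; exact: measurable_indic.
  - have mp : measurable_fun [set: measurableTypeR R] (normal_pdf 0 s1).
      exact: measurable_normal_pdf.
    exact: (measurableT_comp mp measurable_fst).
have f0 p : (0 <= f p)%E by rewrite /f -!EFinM lee_fin !mulr_ge0 ?normal_pdf_ge0.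
have mpdf m s :
    measurable_fun [set: measurableTypeR R] (fun y => (normal_pdf m s y)%:E).
  by apply/measurable_EFinP; exact: measurable_normal_pdf.
transitivity (\int[mu]_x \int[mu]_y f (x, y))%E.
  apply: eq_integral => x _; rewrite normal_probE // -ge0_integralZr //=.
  - apply: emeasurable_funM; first exact: mpdf.
    by apply/measurable_EFinP; exact: measurable_indic.
  - by move=> y _; rewrite -EFinM lee_fin mulr_ge0 ?normal_pdf_ge0.
  - by rewrite lee_fin normal_pdf_ge0.
rewrite fubini_tonelli // normal_probE //; apply: eq_integral => y _.
under eq_integral => x _.
  rewrite /f /= -!EFinM mulrAC normal_pdf_mul // mulrAC EFinM; over.
rewrite ge0_integralZl //= ?integral_normal_pdf ?mule1 //.
- by move=> x _; rewrite lee_fin normal_pdf_ge0.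
- by rewrite lee_fin mulr_ge0 ?normal_pdf_ge0.
Qed.

Lemma gauss1_shift b s B : measurable B ->
  gauss1 0 s [set y | B (b + y)] = gauss1 b s B.
Proof.
move=> mB; rewrite /gauss1; case: eqVneq => [_|s0].
  by rewrite !diracE; congr (nat_of_bool _)%:R%:E;
  apply/idP/idP; rewrite !inE /= addr0.
have -> : [set y | B (b + y)] = affine 1 b @^-1` B.
  by apply/seteqP; split=> y; rewrite /= /affine mul1r addrC.
by rewrite normal_prob_affine ?oner_neq0 // mulr0 add0r normr1 mul1r.
Qed.

(** The law of [a X + Y] for independent [X], [Y] with laws [N(0, 1)] and [N(0, s^2)]. The cases
    [a = 0] and [s = 0] are separate because one summand is then a point mass. *)
Lemma gauss1_conv a s B : 0 <= s -> measurable B ->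
  (\int[normal_prob (0 : R) 1]_x gauss1 0 s [set y | B ((a * x : R) + y)%R]
   = gauss1 0 (Num.sqrt (a ^+ 2 + s ^+ 2)) B)%E.
Proof.
move=> s0 mB; under eq_integral do rewrite gauss1_shift //.
have [->|a0] := eqVneq a 0.
  rewrite expr0n add0r sqrtr_sqr ger0_norm //.
  under eq_integral do rewrite mul0r.
  by rewrite integral_cst // -[RHS]mule1; congr (_ * _)%E; exact: probability_setT.
have na0 : `|a| != 0 by rewrite normr_eq0.
have affE (x : R) : a * x = affine a 0 x by rewrite /affine addr0.
have NA C : measurable C ->
    normal_prob 0 1 (affine a 0 @^-1` C) = normal_prob 0 `|a| C.
  move=> mC; have := @normal_prob_affine R a 0 0 1 C a0 (oner_neq0 R) mC.
  by rewrite mulr0 addr0 mulr1.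
have sq0 : Num.sqrt (a ^+ 2 + s ^+ 2) != 0.
  by rewrite gt_eqF // sqrtr_gt0 ltr_wpDr ?sqr_ge0 // exprn_even_gt0.
rewrite [RHS]/gauss1 (negbTE sq0); have [s00|sn0] := eqVneq s 0.
  rewrite s00 expr0n addr0 sqrtr_sqr -NA //.
  rewrite -[X in _ = normal_prob 0 1 X]setIT -integral_indic //.
    apply: eq_integral => x _; rewrite /gauss1 eqxx diracE indicE affE.
    by congr (nat_of_bool _)%:R%:E; apply/idP/idP; rewrite !inE.
  by rewrite -[X in measurable X]setTI; exact: measurable_affine.
have -> : a ^+ 2 = `|a| ^+ 2 by rewrite real_normK ?num_real.
rewrite -(normal_prob_conv na0 sn0 mB).
have mN := measurable_normal_prob_mean sn0 mB.
transitivity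
  (\int[pushforward (normal_prob 0 1) (affine a 0)]_x normal_prob x s B)%E.
  rewrite ge0_integral_pushforward //; apply: eq_integral => x _.
  by rewrite /gauss1 (negbTE sn0) affE.
by apply: eq_measure_integral => C mC _; exact: NA.
Qed.

(** Induction on the dimension: an independent standard normal coordinate is prepended through a
    product measure, and [gauss1_conv] adds its contribution to each linear functional. *)
Lemma standard_normal_vector n : exists P : probability (Rvec R n) R,
  forall (a : 'cV[R]_n) B, measurable B ->
    P [set t | B (dotv a (vec t))] = gauss1 0 (norm2 a) B.
Proof.
elim: n => [|n [P IH]].
  exists (dirac ([tuple] : Rvec R 0)) => a B mB.
  have d0 t : dotv a (vec t) = 0 by rewrite dotvE big_ord0.
  have -> : norm2 a = 0 by rewrite /norm2 dotvE big_ord0 sqrtr0.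
  rewrite /gauss1 (eqxx (0 : R)) !diracE.
  by congr (nat_of_bool _)%:R%:E; apply/idP/idP; rewrite !inE /= d0.
pose f (p : measurableTypeR R * Rvec R n) : Rvec R n.+1 :=
  [the n.+1.-tuple _ of p.1 :: p.2].
have mf : measurable_fun setT f by apply: measurable_cons.
pose mF := isMeasurableFun.Build _ _ _ _ f mf.
pose F : {mfun _ >-> _} := HB.pack f mF.
pose N : probability (measurableTypeR R) R := normal_prob 0 1.
exists (distribution (N \x P)%E F) => a B mB.
pose a' : 'cV[R]_n := \col_i a (lift ord0 i) 0.
have dE x t : dotv a (vec (f (x, t))) = a 0 0 * x + dotv a' (vec t).
  rewrite !dotvE big_ord_recl; congr (_ * _ + _); first by rewrite mxE tnth0.
  by apply: eq_bigr => i _; rewrite !mxE tnthS.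
have nE : norm2 a = Num.sqrt (a 0 0 ^+ 2 + norm2 a' ^+ 2).
  rewrite sqr_norm2 /norm2 !dotvE big_ord_recl -expr2; congr (Num.sqrt (_ + _)).
  by apply: eq_bigr => i _; rewrite !mxE.
rewrite nE -gauss1_conv ?norm2_ge0 //.
(* By definition, the product measure integrates the measures of the sections. *)
rewrite -[LHS]/(\int[N]_x P (xsection [set p | B (dotv a (vec (f p)))] x))%E.
apply: eq_integral => x _.
have -> : xsection [set p | B (dotv a (vec (f p)))] x
    = [set t | [set y | B (a 0 0 * x + y)] (dotv a' (vec t))].
  by apply/seteqP; split=> t /=; rewrite /xsection /= inE /= dE.
rewrite IH //; have -> : [set y | B (a 0 0 * x + y)] = affine 1 (a 0 0 * x) @^-1` B.
  by apply/seteqP; split=> y; rewrite /= /affine mul1r addrC.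
by rewrite -[X in measurable X]setTI; exact: measurable_affine.
Qed.

(** The image of a standard normal vector under [t -> m + A t]; [A] may be singular, so degenerate
    covariances are covered. *)
Lemma gaussian_exists n (m : 'cV[R]_n) (A : 'M[R]_n) :
  exists Q : probability (Rvec R n) R, gaussian m (A *m A^T) Q.
Proof.
have [P hP] := standard_normal_vector n.
pose f (t : Rvec R n) : Rvec R n := [tuple (m + A *m vec t) i 0 | i < n].
have mf : measurable_fun setT f.
  apply/measurable_fun_tnthP => i.
  have -> : (@tnth n _ ^~ i \o f) =
      (fun t : Rvec R n => m i 0 + \sum_j A i j * tnth t j).
    apply/funext => t /=; rewrite tnth_mktuple !mxE; congr (_ + _).
    by apply: eq_bigr => j _; rewrite mxE.
  apply: measurable_funD => //; apply: measurable_sum => j.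
  by apply: measurable_funM => //; exact: measurable_tnth.
pose mF := isMeasurableFun.Build _ _ _ _ f mf.
pose F : {mfun _ >-> _} := HB.pack f mF.
exists (distribution P F) => u B mB.
have dE t : dotv u (vec (f t)) = dotv u m + dotv (A^T *m u) (vec t).
  rewrite -dotv_mulmx !(dotvC u) -dotvDl; congr (dotv _ u).
  by apply/colP => i; rewrite mxE tnth_mktuple.
rewrite qform_mul -[Num.sqrt _]/(norm2 (A^T *m u)) -gauss1_shift // -hP.
  by congr (P _); apply/seteqP; split=> t /=; rewrite /F /= dE.
have -> : [set y | B (dotv u m + y)] = affine 1 (dotv u m) @^-1` B.
  by apply/seteqP; split=> y; rewrite /= /affine mul1r addrC.
by rewrite -[X in measurable X]setTI; exact: measurable_affine.
Qed.

Lemma measurable_unfavorable n (x : 'cV[R]_n) : measurable (unfavorable x).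
Proof.
rewrite (_ : unfavorable x =
  (fun t : Rvec R n => \sum_i tnth t i * x i 0) @^-1` `]-oo, 0%R]).
  rewrite -[X in measurable X]setTI; apply: measurable_sum => // i.
  by apply: measurable_funM => //; exact: measurable_tnth.
have dE t : dotv (vec t) x = \sum_i tnth t i * x i 0.
  by rewrite dotvE; apply: eq_bigr => i _; rewrite mxE.
by apply/seteqP; split=> t; rewrite /unfavorable /= in_itv /= dE.
Qed.

Lemma Phi_EFin z : (Phi z)%:E = normal_prob (0 : R) 1 `]-oo, z].
Proof. by rewrite fineK // fin_num_measure. Qed.

End gaussian_vector.

(** * The standard normal distribution function *)

Section Phi.
Context {R : realType}.
Notation mu := (@lebesgue_measure R).
Implicit Types (a b m s z : R) (B : set (measurableTypeR R)).

(** The law is invariant under [x -> - x], and the endpoint [z] can be added to the complementary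
    ray since it carries no mass. *)
Lemma PhiN z : Phi (- z) = 1 - Phi z.
Proof.
have mB : measurable (`[z, +oo[ : set (measurableTypeR R)) by exact: measurable_itv.
apply: EFin_inj; rewrite EFinB !Phi_EFin -probability_setC // setCitvl.
transitivity (normal_prob (0 : R) 1 `[z, +oo[); last first.
  rewrite /normal_prob; apply/esym/integral_itv_obnd_cbnd.
  by apply/measurable_funTS/measurable_EFinP; exact: measurable_normal_pdf.
have -> : `]-oo, - z]%classic = affine (-1) 0 @^-1` `[z, +oo[.
  apply/seteqP; split=> x; rewrite /affine /= !in_itv /= andbT addr0 mulN1r;
  by rewrite lerNr.
by rewrite normal_prob_affine ?oppr_eq0 ?oner_neq0 // mulr0 addr0 mulr1 normrN1.
Qed.

Lemma Phi_le z t : z <= t -> Phi z <= Phi t.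
Proof.
move=> zt; rewrite -lee_fin !Phi_EFin; apply: le_measure; rewrite ?inE //.
by apply: subset_itvl; rewrite bnd_simp.
Qed.

Lemma Phi0 : Phi (0 : R) = 2^-1.
Proof. by have := PhiN 0; rewrite oppr0; lra. Qed.

(** The density decreases on the positive axis, so []0, z]] has mass at least [z] times the density
    at [z]. *)
Lemma Phi_gt_half z : 0 < z -> 2^-1 < Phi z.
Proof.
move=> z0; rewrite -Phi0 -lte_fin !Phi_EFin.
have -> : `]-oo, z]%classic = `]-oo, 0%R] `|` `]0%R, z] :> set R.
  apply/seteqP; split=> x /=; rewrite !in_itv /=; last by case; lra.
  by move=> xz; case: (lerP x 0) => x0; [left|right].
have dis : `]-oo, 0%R] `&` `]0%R, z] = set0 :> set R.
  by apply/seteqP; split=> x //= []; rewrite !in_itv /=; lra.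
rewrite measureU //= lteDl ?fin_num_measure //.
have pz0 : 0 < normal_pdf 0 1 z.
  by rewrite normal_pdfE ?oner_neq0 // mulr_gt0 ?expR_gt0 ?normal_peak_gt0
    ?oner_neq0.
apply: (@lt_le_trans _ _ (\int[mu]_(x in `]0%R, z]) (normal_pdf 0 1 z)%:E)%E).
  rewrite integral_cst //= lebesgue_measure_itv /= lte_fin z0 -EFinB -EFinM lte_fin.
  by rewrite mulr_gt0 ?subr0.
apply: ge0_le_integral => //.
- by move=> x _; rewrite lee_fin ltW.
- by apply/measurable_funTS/measurable_EFinP; exact: measurable_normal_pdf.
- move=> x; rewrite /= in_itv /= => /andP[x0 xz].
  rewrite lee_fin !normal_pdfE ?oner_neq0 // ler_wpM2l ?normal_peak_ge0 //.
  rewrite ler_expR ler_wpM2r ?invr_ge0 // lerN2 !subr0.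
  by rewrite ler_pXn2r ?nnegrE // ltW.
Qed.

Lemma gauss1_ray m s : 0 < s -> gauss1 m s `]-oo, 0%R] = (1 - Phi (m / s))%:E.
Proof.
move=> s0; rewrite /gauss1 gt_eqF // -PhiN Phi_EFin.
have -> : `]-oo, - (m / s)]%classic = affine s m @^-1` `]-oo, 0%R].
  apply/seteqP; split=> x; rewrite /affine /= !in_itv /=;
  by rewrite -mulNr ler_pdivlMr // mulrC -lerBrDr sub0r.
have s1 : s != 0 by rewrite gt_eqF.
rewrite (@normal_prob_affine _ s m 0 1 _ s1 (oner_neq0 R)) //.
by rewrite mulr0 add0r mulr1 gtr0_norm.
Qed.

End Phi.

(** * Worst case over a Gelbrich ball *)

Section tangent.
Context {R : rcfType} (mu0 s0 r : R).
Hypotheses (r0 : 0 <= r) (rmu : r < mu0) (s00 : 0 < s0).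
Let L := Num.sqrt (mu0 ^+ 2 + s0 ^+ 2 - r ^+ 2).
Let h := mu0 ^+ 2 + s0 ^+ 2.

(* [(tangent_cos, tangent_sin)] directs the lower tangent line from the origin
   to the disc of centre [(s0, mu0)] and radius [r]. *)
Definition tangent_cos := (s0 * L + r * mu0) / h.
Definition tangent_sin := (mu0 * L - r * s0) / h.
Definition tangent_slope := (mu0 ^+ 2 - r ^+ 2) / (mu0 * s0 + r * L).

Let mu00 : 0 < mu0. Proof. exact: le_lt_trans r0 rmu. Qed.
Let h0 : 0 < h. Proof. by rewrite /h addr_gt0 // exprn_gt0. Qed.
Let rmu2 : 0 < mu0 ^+ 2 - r ^+ 2.
Proof. by rewrite subr_gt0 ltr_pXn2r ?nnegrE // ltW. Qed.
Let L2 : L ^+ 2 = mu0 ^+ 2 + s0 ^+ 2 - r ^+ 2.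
Proof. by rewrite sqr_sqrtr // addrAC addr_ge0 ?sqr_ge0 // ltW. Qed.
Let L0 : 0 < L.
Proof. by rewrite sqrtr_gt0 addrAC addr_gt0 // exprn_gt0. Qed.
Let d0 : 0 < mu0 * s0 + r * L.
Proof. by rewrite ltr_wpDr ?mulr_gt0 // mulr_ge0 // ltW. Qed.

Lemma tangent_cos_gt0 : 0 < tangent_cos.
Proof. by rewrite divr_gt0 // ltr_wpDr ?mulr_gt0 // mulr_ge0 // ltW. Qed.

Lemma tangent_slope_gt0 : 0 < tangent_slope.
Proof. by rewrite divr_gt0. Qed.

(** After clearing denominators and replacing [L ^+ 2], both sides equal
    [(mu0^2 - r^2) (s0 L + r mu0)]. *)
Lemma tangent_slopeE : tangent_slope * tangent_cos = tangent_sin.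
Proof.
rewrite /tangent_slope /tangent_cos /tangent_sin mulrA; congr (_ / _).
apply: (mulIf (lt0r_neq0 d0)); rewrite mulrAC divfK ?lt0r_neq0 //.
have -> : (mu0 * L - r * s0) * (mu0 * s0 + r * L)
   = mu0 ^+ 2 * s0 * L + mu0 * r * (L ^+ 2 - s0 ^+ 2) - r ^+ 2 * s0 * L by ring.
rewrite L2; ring.
Qed.

Lemma tangent_sin_ge0 : 0 <= tangent_sin.
Proof.
by rewrite -tangent_slopeE mulr_ge0 // ltW ?tangent_slope_gt0 ?tangent_cos_gt0.
Qed.

Lemma tangent_cos2Dsin2 : tangent_cos ^+ 2 + tangent_sin ^+ 2 = 1.
Proof.
have hn : h != 0 by rewrite lt0r_neq0.
rewrite /tangent_cos /tangent_sin !expr_div_n -mulrDl.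
have -> : (s0 * L + r * mu0) ^+ 2 + (mu0 * L - r * s0) ^+ 2 = h * (L ^+ 2 + r ^+ 2).
  by rewrite /h; ring.
by rewrite L2 subrK -expr2 divff ?expf_neq0.
Qed.

(** The left side is the distance from the centre [(s0, mu0)] to the tangent line, along the normal
    [(- tangent_sin, tangent_cos)]. *)
Lemma tangent_dist : mu0 * tangent_cos - s0 * tangent_sin = r.
Proof.
have hn : mu0 ^+ 2 + s0 ^+ 2 != 0 by rewrite lt0r_neq0.
by rewrite /tangent_cos /tangent_sin /h; field.
Qed.

(** The contact point is the centre moved by [r] against that normal; its slope is that of the
    tangent. *)
Lemma tangent_point :
  (mu0 - r * tangent_cos) / (s0 + r * tangent_sin) = tangent_slope.
Proof.
have d : 0 < s0 + r * tangent_sin.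
  by apply: ltr_wpDr => //; exact: mulr_ge0 r0 tangent_sin_ge0.
apply: (mulIf (lt0r_neq0 d)); rewrite divfK ?lt0r_neq0 //.
apply: (mulIf (lt0r_neq0 tangent_cos_gt0)).
rewrite mulrAC tangent_slopeE.
have := tangent_cos2Dsin2; have := tangent_dist.
set c := tangent_cos; set s := tangent_sin => E1 E2.
have -> : (mu0 - r * c) * c = mu0 * c - r * c ^+ 2 by ring.
have -> : mu0 * c = r + s0 * s by rewrite -E1; ring.
have -> : c ^+ 2 = 1 - s ^+ 2 by rewrite -E2; ring.
ring.
Qed.

(** The disc lies above the tangent: the signed distance of [(s, m)] to the line is [r] plus the
    component of its displacement along the unit normal, which is at least [- r] by
    Cauchy-Schwarz. *)
Lemma tangent_slope_le m s :
  (m - mu0) ^+ 2 + (s - s0) ^+ 2 <= r ^+ 2 -> tangent_slope * s <= m.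
Proof.
move=> H; rewrite -(ler_pM2r tangent_cos_gt0) mulrAC tangent_slopeE.
have := tangent_cos2Dsin2; have := tangent_dist.
set c := tangent_cos; set t := tangent_sin => E1 E2.
have -> : m * c = r + t * s + ((m - mu0) * c - (s - s0) * t) by rewrite -E1; ring.
rewrite addrAC lerDr -lerBlDl sub0r.
have : `|(m - mu0) * c - (s - s0) * t| <= r.
  rewrite -(@ler_pXn2r _ 2) ?nnegrE // real_normK ?num_real //.
  apply: le_trans H; rewrite -subr_ge0.
  have -> : (m - mu0) ^+ 2 + (s - s0) ^+ 2 - ((m - mu0) * c - (s - s0) * t) ^+ 2
    = ((m - mu0) ^+ 2 + (s - s0) ^+ 2) * (1 - (c ^+ 2 + t ^+ 2))
      + ((m - mu0) * t + (s - s0) * c) ^+ 2 by ring.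
  by rewrite E2 subrr mulr0 add0r sqr_ge0.
by rewrite ler_norml => /andP[].
Qed.

End tangent.

(** * Extremal distributions in a Gaussian ball *)

Section gaussian_ball.
Context {R : realType} {d : nat}.
Implicit Types (m x : 'cV[R]_d) (S : 'M[R]_d) (rho : R).

Lemma gaussian_unfavorable m S (Q : probability (Rvec R d) R) x :
  gaussian m S Q ->
  Q (unfavorable x) = gauss1 (dotv m x) (Num.sqrt (qform S x)) `]-oo, 0%R].
Proof.
move=> QG; rewrite (dotvC m) -QG; last exact: measurable_itv.
by congr (Q _); apply/seteqP; split=> t; rewrite /unfavorable /= in_itv /= dotvC.
Qed.

Lemma gE m S rho x : 0 <= qform S x ->
  g m S rho x = tangent_slope (dotv m x) (Num.sqrt (qform S x)) (rho * norm2 x).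
Proof. by move=> S0; rewrite /g /tangent_slope exprMn (sqr_sqrtr S0). Qed.

(** The budget [rho] is spent along [x] only: [t] shifts the mean of the score and [c] widens its
    deviation. The bound assumed is on the squared distance of [gelbrich_stretch]. *)
Lemma gaussian_ball_stretch m S rho x (t c : R) : pdmx S -> 0 <= c -> 0 <= rho ->
    (t * norm2 x) ^+ 2 + (c * norm2 x) ^+ 2 * qform S x <= rho ^+ 2 ->
  exists2 Q, gaussian_ball m S rho Q & Q (unfavorable x)
    = gauss1 (dotv m x - t * norm2 x ^+ 2)
        ((1 + c * norm2 x ^+ 2) * Num.sqrt (qform S x)) `]-oo, 0%R].
Proof.
move=> Spd c0 rho0 H; have Sp := pdmx_psd Spd.
have [Q QG] := gaussian_exists (m - t *: x) (stretch S c x).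
exists Q; last first.
  by rewrite (gaussian_unfavorable x QG) qform_stretch // dotvBl dotvZl sqr_norm2.
exists (m - t *: x), (stretch S c x *m (stretch S c x)^T).
split=> //; first exact: psdmx_mul_tr.
by rewrite gelbrich_stretch // -[leRHS](ger0_norm rho0) -sqrtr_sqr ler_wsqrtr.
Qed.

Section feasible.
Context m S rho x (Spd : pdmx S) (rho0 : 0 <= rho).
Hypothesis (mx : rho * norm2 x < dotv m x).

Let x0 : x != 0.
Proof.
apply: contraTneq mx => ->; rewrite dotvC -(scale0r (0 : 'cV_d)) dotvZl mul0r.
by rewrite -leNgt mulr_ge0 ?norm2_ge0.
Qed.
Let s0 : 0 < Num.sqrt (qform S x).
Proof. by rewrite sqrtr_gt0 Spd.2. Qed.
Let r0 : 0 <= rho * norm2 x. Proof. by rewrite mulr_ge0 ?norm2_ge0. Qed.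
Let gS : g m S rho x
  = tangent_slope (dotv m x) (Num.sqrt (qform S x)) (rho * norm2 x).
Proof. by rewrite gE // ltW // Spd.2. Qed.

Lemma g_gt0 : 0 < g m S rho x.
Proof. by rewrite gS tangent_slope_gt0. Qed.

Lemma gaussian_ball_unfavorable_le Q : gaussian_ball m S rho Q ->
  (Q (unfavorable x) <= (1 - Phi (g m S rho x))%:E)%E.
Proof.
move=> [m' [S' [S'p QG Gle]]]; rewrite (gaussian_unfavorable x QG).
have := gelbrich_dotv_qform x S'p Spd rho0 Gle.
move=> /(tangent_slope_le r0 mx s0); rewrite -gS => gle.
have [s'0|s'0] := eqVneq (Num.sqrt (qform S' x)) 0; last first.
  have s'1 : 0 < Num.sqrt (qform S' x) by rewrite lt_neqAle eq_sym s'0 sqrtr_ge0.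
  by rewrite gauss1_ray // lee_fin lerB // Phi_le // ler_pdivlMr.
have Phi1 z : 0 <= 1 - Phi z :> R.
  by rewrite subr_ge0 -lee_fin Phi_EFin probability_le1.
(* For zero deviation the slope bound gives only a nonnegative mean, while a point mass at 0 would
   have probability 1. Strict positivity comes from the disc, whose radius is less than the mean at
   its centre. *)
have aux (a b c r : R) : 0 <= r -> r < b ->
    (a - b) ^+ 2 + (0 - c) ^+ 2 <= r ^+ 2 -> 0 < a.
  by move=> r_ge0 rb H; rewrite ltNge; apply/negP => a0; nra.
have m'0 : 0 < dotv m' x.
  have := gelbrich_dotv_qform x S'p Spd rho0 Gle; rewrite s'0.
  exact: aux r0 mx.
rewrite /gauss1 s'0 eqxx diracE memNset /= ?lee_fin //.
by rewrite in_itv /= leNgt m'0.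
Qed.

Lemma gaussian_ball_unfavorable_attained :
  exists2 Q, gaussian_ball m S rho Q
    & Q (unfavorable x) = (1 - Phi (g m S rho x))%:E.
Proof.
pose co := tangent_cos (dotv m x) (Num.sqrt (qform S x)) (rho * norm2 x).
pose si := tangent_sin (dotv m x) (Num.sqrt (qform S x)) (rho * norm2 x).
have n0 := norm2_gt0 x0.
have nn0 : norm2 x != 0 by rewrite gt_eqF.
have sn0 : Num.sqrt (qform S x) != 0 by rewrite gt_eqF.
have si0 : 0 <= si by exact: tangent_sin_ge0.
(* These values send mean and deviation to the contact point of the tangent; the cost is
   [rho ^+ 2 * (co ^+ 2 + si ^+ 2)], the whole budget. *)
pose t := rho * co / norm2 x.
pose c := rho * si / (norm2 x * Num.sqrt (qform S x)).
have c0 : 0 <= c by apply: divr_ge0; apply: mulr_ge0 => //; exact: ltW.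
have E1 : t * norm2 x ^+ 2 = rho * norm2 x * co by rewrite /t; field.
have E2 : (1 + c * norm2 x ^+ 2) * Num.sqrt (qform S x)
    = Num.sqrt (qform S x) + rho * norm2 x * si.
  by rewrite /c; field; rewrite nn0 sn0.
have H : (t * norm2 x) ^+ 2 + (c * norm2 x) ^+ 2 * qform S x <= rho ^+ 2.
  have -> : t * norm2 x = rho * co by rewrite /t; field.
  have -> : qform S x = Num.sqrt (qform S x) ^+ 2.
    by rewrite sqr_sqrtr // ltW // Spd.2.
  rewrite -exprMn.
  have -> : c * norm2 x * Num.sqrt (qform S x) = rho * si.
    by rewrite /c; field; rewrite nn0 sn0.
  have cs : co ^+ 2 + si ^+ 2 = 1 by exact: tangent_cos2Dsin2.
  have -> : (rho * co) ^+ 2 + (rho * si) ^+ 2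
    = rho ^+ 2 * (co ^+ 2 + si ^+ 2) by ring.
  by rewrite cs mulr1.
have [Q QB QE] := gaussian_ball_stretch m Spd c0 rho0 H.
exists Q => //; rewrite QE E1 E2 gauss1_ray; last first.
  by rewrite ltr_wpDr // mulr_ge0.
by rewrite tangent_point // -gS.
Qed.

End feasible.

(** If [x = 0] the event is the whole space and the nominal law serves. Otherwise the whole budget
    goes to the mean, which drops by [rho * norm2 x] and becomes nonpositive. *)
Lemma gaussian_ball_unfavorable_ge_half m S rho x : pdmx S -> 0 <= rho ->
    dotv m x <= rho * norm2 x ->
  exists2 Q, gaussian_ball m S rho Q & ((2^-1)%:E <= Q (unfavorable x))%E.
Proof.
move=> Spd rho0 mx; have [x0|x0] := eqVneq x 0.
  have [|Q QB _] := @gaussian_ball_stretch m S rho x 0 0 Spd (lexx 0) rho0.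
    by rewrite !mul0r expr0n mul0r addr0 sqr_ge0.
  exists Q => //; have -> : unfavorable x = [set: Rvec R d].
    apply/seteqP; split=> // t _; rewrite /unfavorable /= x0 dotvC.
    by rewrite -(scale0r (0 : 'cV_d)) dotvZl mul0r.
  by rewrite probability_setT lee_fin; lra.
have n0 := norm2_gt0 x0; have nn0 : norm2 x != 0 by rewrite gt_eqF.
have [|Q QB QE] :=
  @gaussian_ball_stretch m S rho x (rho / norm2 x) 0 Spd (lexx 0) rho0.
  by rewrite divfK // mul0r expr0n mul0r addr0.
exists Q => //; rewrite QE mul0r addr0 mul1r.
have s0 : 0 < Num.sqrt (qform S x) by rewrite sqrtr_gt0 Spd.2.
rewrite gauss1_ray // lee_fin -PhiN -Phi0 Phi_le // oppr_ge0 pmulr_lle0 ?invr_gt0 //.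
by rewrite subr_le0 expr2 mulrA divfK.
Qed.

End gaussian_ball.

(** * Mixtures and the final equivalence *)

Lemma mixture_exists (R : realType) (d K : nat) (p : 'I_K -> R)
    (Qs : 'I_K -> probability (Rvec R d) R) :
    (forall k, 0 <= p k) -> \sum_(k < K) p k = 1 ->
  exists Q, is_mixture p Qs Q.
Proof.
move=> p0 p1.
(* [msum] takes a sequence indexed by [nat], so the weighted components are extended by the null
   measure. *)
pose w (i : nat) : {measure set (Rvec R d) -> \bar R} :=
  if insub i is Some k then mscale (NngNum (p0 k)) (Qs k) else mzero.
have wE (k : 'I_K) B : w k B = ((p k)%:E * Qs k B)%E by rewrite /w valK.
have ME B : msum w K B = (\sum_(k < K) (p k)%:E * Qs k B)%E.
  by apply: eq_bigr => k _; rewrite wE.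
have M1 : msum w K [set: Rvec R d] = 1%E.
  rewrite ME; under eq_bigr do rewrite probability_setT mule1.
  by rewrite sumEFin p1.
pose MP := Measure_isProbability.Build _ _ _ (msum w K) M1.
pose Q : probability _ _ := HB.pack (msum w K) MP.
by exists Q => B _; rewrite -ME.
Qed.

Theorem theorem4p1 (R : realType) (d K : nat) (hd : (0 < d)%N) (hK : (0 < K)%N)
    (X : set 'cV[R]_d) (x0 : 'cV[R]_d) (delta : R) (hdelta : 0 <= delta)
    (c : 'cV[R]_d -> 'cV[R]_d -> R)
    (c_ge0 : forall x y, 0 <= c x y)
    (c_cont : continuous (fun z : 'cV[R]_d * 'cV[R]_d => c z.1 z.2))
    (theta_hat : 'I_K -> 'cV[R]_d) (Sigma_hat : 'I_K -> 'M[R]_d)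
    (hSigma : forall k, pdmx (Sigma_hat k))
    (rho : 'I_K -> R) (hrho : forall k, 0 <= rho k)
    (p_hat : 'I_K -> R) (p_ge0 : forall k, 0 <= p_hat k)
    (p_sum : \sum_(k < K) p_hat k = 1) :
  robust_feasible X x0 delta c theta_hat Sigma_hat rho
    = finite_feasible X x0 delta c theta_hat rho
  /\ forall x, finite_feasible X x0 delta c theta_hat rho x ->
       worst_case (mixture_ball p_hat theta_hat Sigma_hat rho) x
       = (1 - \sum_(k < K) p_hat k
                * Phi (g (theta_hat k) (Sigma_hat k) (rho k) x))%:E.
Proof.
split.
  apply/seteqP; split=> x [Xx cx H]; split=> // k; have := H k.
    rewrite addrC subr_lt0 => wc; rewrite ltNge; apply/negP => mx.
    have [Q QB Qge] := gaussian_ball_unfavorable_ge_half (hSigma k) (hrho k) mx.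
    have : (Q (unfavorable x) <= worst_case
        (gaussian_ball (theta_hat k) (Sigma_hat k) (rho k)) x)%E.
      by apply: ereal_sup_ubound; exists Q.
    by move=> /(le_trans Qge); rewrite leNgt wc.
  rewrite addrC subr_lt0 => mx.
  (* The strict inequality survives the supremum because this bound is uniform over the ball and
     itself below one half. *)
  apply: (@le_lt_trans _ _ (1 - Phi (g (theta_hat k) (Sigma_hat k) (rho k) x))%:E).
    by apply: ge_ereal_sup => _ [Q QB <-]; exact: gaussian_ball_unfavorable_le.
  rewrite lte_fin; have := Phi_gt_half (g_gt0 (hSigma k) (hrho k) mx); lra.
move=> x [_ _ H].
have mx k : rho k * norm2 x < dotv (theta_hat k) x.
  by rewrite -subr_lt0 addrC; exact: H.
have -> : (1 - \sum_(k < K) p_hat k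
                 * Phi (g (theta_hat k) (Sigma_hat k) (rho k) x))%:E
    = (\sum_(k < K) (p_hat k)%:E
         * (1 - Phi (g (theta_hat k) (Sigma_hat k) (rho k) x))%:E)%E.
  under [RHS]eq_bigr do rewrite -EFinM mulrBr mulr1.
  by rewrite sumEFin sumrB p_sum.
apply/eqP; rewrite eq_le; apply/andP; split.
  apply: ge_ereal_sup => _ [Q [Qs [QsB QM]] <-].
  rewrite QM; last exact: measurable_unfavorable.
  apply: lee_sum => k _; apply: lee_wpmul2l; first by rewrite lee_fin.
  by apply: gaussian_ball_unfavorable_le => //; exact: QsB.
(* The worst components can be chosen independently, and their mixture attains the supremum. *)
have /choice [Qs QsP] (k : 'I_K) : exists Q,
    gaussian_ball (theta_hat k) (Sigma_hat k) (rho k) Q /\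
    Q (unfavorable x) = (1 - Phi (g (theta_hat k) (Sigma_hat k) (rho k) x))%:E.
  have [Q QB QE] := gaussian_ball_unfavorable_attained (hSigma k) (hrho k) (mx k).
  by exists Q.
have [Q QM] := mixture_exists Qs p_ge0 p_sum.
apply: ereal_sup_ubound; exists Q.
  by exists Qs; split=> // k; have [] := QsP k.
rewrite QM; last exact: measurable_unfavorable.
by apply: eq_bigr => k _; have [_ ->] := QsP k.
Qed.
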